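(* Let $T$ be a regular uniform-distribution-preserving transformation and let $V\sim\mathcal{U}(0,1)$ and $Z\sim\mathcal{U}(0,1)$ be independent. Then $T^\leftarrow(V,Z)\sim\mathcal{U}(0,1)$.
   Context: A function $T:[0,1]\to[0,1]$ is uniform-distribution-preserving (udp) if $T(U)\sim\mathcal{U}(0,1)$ whenever $U\sim\mathcal{U}(0,1)$. A udp transformation is regular if there is a finite partition $0=a_0<a_1<\dots<a_L=1$ such that $T$ is continuously differentiable on each $A_\ell=(a_{\ell-1},a_\ell)$, $\ell=1,\dots,L$. Let $A=\bigcup_{\ell}A_\ell$. The stochastic inverse of a regular udp transformation $T$ is defined as follows: for $x\in T(A)$, let $\{u\in A: T(u)=x\}=\{r_1(x),\dots,r_{n(x)}(x)\}$ (this set is finite and the weights below sum to one); let $G_x$ be the distribution function of the discrete random variable taking value $r_i(x)$ with probability $1/|T'(r_i(x))|$, $i=1,\dots,n(x)$, and set $T^\leftarrow(x,Z)=G_x^{-1}(Z)$, where $G^{-1}(z)=\inf\{t:G(t)\ge z\}$. For $x\notin T(A)$ set $T^\leftarrow(x,Z)=0$. *)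

(* Defs.v *)
From HB Require Import structures.
From mathcomp Require Import all_boot all_order all_algebra.
From mathcomp Require Import all_classical all_reals all_analysis.
Set Implicit Arguments. Unset Strict Implicit. Unset Printing Implicit Defensive.
Import Order.TTheory GRing.Theory Num.Theory.
Import numFieldNormedType.Exports.
Local Open Scope classical_set_scope.
Local Open Scope ring_scope.

Definition unif01 (R : realType) := uniform_prob (@ltr01 R).
Arguments unif01 R : clear implicits.

Definition is_unif01 (R : realType) (d : measure_display) (O : measurableType d)
    (P : probability O R) (X : O -> R) : Prop :=
  measurable_fun setT X /\
  forall B : set R, measurable B -> P (X @^-1` B) = unif01 R B.

Definition indep2 (R : realType) (d : measure_display) (O : measurableType d)
    (P : probability O R) (X Y : O -> R) : Prop :=
  forall A B : set R, measurable A -> measurable B ->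
    P (X @^-1` A `&` Y @^-1` B) = (P (X @^-1` A) * P (Y @^-1` B))%E.

(* T : [0,1] -> [0,1] (represented as a function R -> R; values off [0,1]
   are irrelevant) is uniform-distribution-preserving: T(U) ~ U(0,1)
   whenever U ~ U(0,1), i.e. the pushforward of U(0,1) under T is U(0,1). *)
Definition udp (R : realType) (T : R -> R) : Prop :=
  (forall u, 0 <= u <= 1 -> 0 <= T u <= 1) /\
  measurable_fun (`[0, 1] : set R) T /\
  forall B : set R, measurable B -> unif01 R (T @^-1` B) = unif01 R B.

Definition is_partition (R : realType) (L : nat) (a : nat -> R) : Prop :=
  (0 < L)%N /\ a 0%N = 0 /\ a L = 1 /\
  (forall l, (l < L)%N -> a l < a l.+1).

Definition piece (R : realType) (a : nat -> R) (l : nat) : set R :=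
  `] a l.-1, a l [.

Definition Aset (R : realType) (L : nat) (a : nat -> R) : set R :=
  [set u | exists2 l, (1 <= l <= L)%N & piece a l u].

Definition regular_wrt (R : realType) (T : R -> R) (L : nat) (a : nat -> R) : Prop :=
  is_partition L a /\
  forall l, (1 <= l <= L)%N ->
    (forall u, piece a l u -> derivable T u 1) /\
    {in piece a l, continuous (derive1 T)}.

Definition Gx (R : realType) (T : R -> R) (L : nat) (a : nat -> R) (x t : R) : R :=
  (\sum_(r \in [set r | Aset L a r /\ T r = x /\ r <= t]) (`|derive1 T r|)^-1)%R.

Definition stoch_inv (R : realType) (T : R -> R) (L : nat) (a : nat -> R) (x z : R) : R :=
  if `[< (T @` Aset L a) x >] then inf [set t | z <= Gx T L a x t] else 0.

(* Main.v *)
Require Import Defs.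
From HB Require Import structures.
From mathcomp Require Import all_boot all_order all_algebra.
From mathcomp Require Import all_classical all_reals all_analysis.
From mathcomp Require Import measurable_realfun lra.
Import Order.TTheory GRing.Theory Num.Theory.
Import numFieldNormedType.Exports.
Local Open Scope classical_set_scope.
Local Open Scope ring_scope.
Set Implicit Arguments. Unset Strict Implicit.

(** T' has no zero on a piece: near a critical point T shortens lengths, which
a map preserving the uniform law cannot do. So T is injective on each piece I_l,
with inverse s_l, and changing variables gives, for every Borel set E,
  int 1{s_l(x) in E} / |T'(s_l(x))| dx = lambda(E n I_l).
Summing over l, put g_E(x) = sum of 1/|T'(r)| over the roots r in E of T r = x;
then int g_E = lambda(E n [0,1]). With E = T^-1(B) this says that the total
weight g_R is almost everywhere the indicator of [0,1], so that G_x, whose value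
at t is g_{]-oo,t]}(x), is a distribution function for almost every x in [0,1].
(At finitely many x the weights may fail to sum to one: a root can be a point of
the partition.) For almost every x the section {z | t < T^<-(x,z)} has uniform measure
g_{]t,+oo[}(x), and integrating over x yields lambda(]t,+oo[ n [0,1]). *)

(** * Measures determined by right rays *)

(** Right rays are closed under intersection and generate the Borel sets, and the rays from [- n%:R]
    exhaust the line with finite [m1]-mass, so uniqueness of measures applies. *)
Lemma eq_measure_rays (R : realType)
    (m1 m2 : {measure set (measurableTypeR R) -> \bar R}) :
  (m1 setT < +oo)%E ->
  (forall x, m1 `]x, +oo[%classic = m2 `]x, +oo[%classic) ->
  forall E, measurable E -> m1 E = m2 E.
Proof.
move=> m1oo m12.
have := @measure_unique _ _ (measurableTypeR R) (@RGenOInfty.G R)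
  (fun n => `](- n%:R), +oo[%classic) _ _ _ _ m1 m2; apply.
- exact: RGenOInfty.measurableE.
- move=> _ _ [x ->] [y ->]; exists (Num.max x y).
  by apply/seteqP; split=> z /=; rewrite !in_itv/= !andbT gt_max => /andP.
- by move=> n; exists (- n%:R).
- apply/seteqP; split=> // x _; exists (Num.bound `|x|) => //=.
  rewrite in_itv/= andbT ltrNl (le_lt_trans (ler_norm _))// normrN.
  by rewrite archi_boundP.
- by move=> _ [x ->].
- by move=> n; rewrite (le_lt_trans _ m1oo)// le_measure// inE//; exact: measurable_itv.
Qed.

(** * Inverse branch and change of variables on one piece *)

Section piece.
Context {R : realType} (T : R -> R) (p q : R).
Local Notation mu := (@lebesgue_measure R).
Hypothesis pq : p < q.
Hypothesis dT : forall u, u \in `]p, q[ -> derivable T u 1.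
Hypothesis cT' : {in `]p, q[, continuous (derive1 T)}.
Hypothesis T'0 : forall u, u \in `]p, q[ -> derive1 T u != 0.

(* The default value [p] lies outside the piece, hence [wgt (binv x) = 0] when [T r = x]
   has no root there. *)
Definition binv (x : R) : R := xget p [set r : R | (r \in `]p, q[) /\ T r = x].
Definition wgt : R -> R := (fun r => `|derive1 T r|^-1) \_ (`]p, q[%classic).

Lemma piece_continuous : {in `]p, q[, continuous T}.
Proof.
by move=> u upq; apply/differentiable_continuous/derivable1_diffP/dT.
Qed.

Lemma segment_sub_piece u v : u \in `]p, q[ -> v \in `]p, q[ -> `[u, v] `<=` `]p, q[.
Proof.
move=> + + x; rewrite /= !in_itv/= => /andP[pu _] /andP[_ vq] /andP[ux xv].
by rewrite (lt_le_trans pu ux) (le_lt_trans xv vq).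
Qed.

(** By Rolle, two points with the same value would enclose a zero of T'. *)
Lemma piece_inj : {in `]p, q[ &, injective T}.
Proof.
suff H u v : u \in `]p, q[ -> v \in `]p, q[ -> u < v -> T u <> T v.
  move=> u v upq vpq uv; apply/eqP; case: ltgtP => // /H; first by move=> /(_ upq vpq).
  by move=> /(_ vpq upq); rewrite uv.
move=> upq vpq uv Tuv.
have sub : `[u, v] `<=` `]p, q[ := segment_sub_piece upq vpq.
have [||c cuv [_ c0]] := Rolle uv _ _ Tuv.
- by move=> x xuv; apply/dT/sub; exact: subset_itv_oo_cc.
- by apply: continuous_in_subspaceT => x; rewrite inE => /sub; exact: piece_continuous.
- have := T'0 (sub _ (subset_itv_oo_cc cuv)).
  by rewrite derive1E c0 eqxx.
Qed.

Lemma binvK : {in `]p, q[, cancel T binv}.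
Proof.
move=> r rpq; rewrite /binv; case: xgetP => [y _ [ypq]|/(_ r)]; last by case.
exact: piece_inj.
Qed.

Lemma binvE x : binv x \in `]p, q[ -> T (binv x) = x.
Proof.
rewrite /binv; case: xgetP => [y _ []//|_].
by rewrite in_itv/= ltxx.
Qed.

Lemma binv_dflt x : binv x \notin `]p, q[ -> binv x = p.
Proof.
by rewrite /binv; case: xgetP => // y _ [-> _].
Qed.

(** The default value [p] lies outside [E], so points without a root do not enter the preimage.
    Measurability of [binv] thereby reduces to that of images under [T]. *)
Lemma binv_preimage (E : set R) : E `<=` `]p, q[ -> binv @^-1` E = T @` E.
Proof.
move=> Epq; apply/seteqP; split=> [x Ex|_ [r Er <-]] /=.
  by exists (binv x) => //; apply: binvE; exact: Epq.
by rewrite binvK//; exact: Epq.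
Qed.

(** A continuous image of an interval is connected, hence an interval, hence Borel. *)
Lemma measurable_image_itv (i : interval R) : [set` i] `<=` `]p, q[ ->
  measurable (T @` [set` i]).
Proof.
move=> ipq; apply: is_interval_measurable; apply/connected_intervalP.
apply: connected_continuous_connected; first exact/connected_intervalP/interval_is_interval.
by apply: continuous_in_subspaceT => x; rewrite inE => /ipq; exact: piece_continuous.
Qed.

Lemma measurable_binv : measurable_fun setT binv.
Proof.
apply: (measurability (@RGenOInfty.G R)); first exact: RGenOInfty.measurableE.
move=> _ [_ [t ->] <-]; rewrite setTI.
(* Since [binv] takes values in [[p, q[], the preimage of the ray is the image of []t, q[] if
   [p <= t], and the whole line if [t < p]. *)
have [pt|tp] := leP p t.
  rewrite (_ : _ @^-1` _ = binv @^-1` (`]t, q[)); last first.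
    apply/seteqP; split=> x /=; rewrite !in_itv/= ?andbT; last by case/andP.
    move=> tx; rewrite tx/=.
    have [|/binv_dflt xp] := boolP (binv x \in `]p, q[); first by rewrite in_itv/= => /andP[].
    by rewrite xp.
  have tq : `]t, q[ `<=` `]p, q[ by apply: subset_itvr; rewrite bnd_simp.
  by rewrite binv_preimage//; exact: measurable_image_itv.
rewrite (_ : _ @^-1` _ = setT)//; apply/seteqP; split=> // x _ /=.
rewrite in_itv/= andbT.
have [|/binv_dflt->//] := boolP (binv x \in `]p, q[).
by rewrite in_itv/= => /andP[+ _]; exact: lt_trans.
Qed.

Lemma wgt_ge0 r : 0 <= wgt r.
Proof. by rewrite /wgt patchE; case: ifPn. Qed.

Lemma continuous_invT' : {in `]p, q[, continuous (fun r => `|derive1 T r|^-1)}.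
Proof.
move=> r rpq; apply: cvgV; first by rewrite normr_eq0 T'0.
by apply: cvg_norm; exact: cT'.
Qed.

Lemma measurable_wgt : measurable_fun setT wgt.
Proof.
apply/measurable_restrict => //; rewrite setTI.
apply: open_continuous_measurable_fun; first exact: interval_open.
by move=> r /[!inE] rpq; exact: continuous_invT'.
Qed.

Lemma continuous_binv r : r \in `]p, q[ -> {for T r, continuous binv}.
Proof.
move=> rpq; suff H : \forall x \near T r, {for x, continuous binv} by exact: nbhs_singleton H.
apply: near_can_continuous.
  by near=> x; apply: binvK; near: x; exact: near_in_itvoo.
by near=> x; apply: piece_continuous; near: x; exact: near_in_itvoo.
Unshelve. all: by end_near. Qed.

Lemma wgt_binv_continuous r : r \in `]p, q[ ->
  {for T r, continuous (wgt \o binv)}.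
Proof.
move=> rpq; apply: continuous_comp; first exact: continuous_binv.
rewrite binvK//; have := continuous_invT' rpq.
rewrite /prop_for /continuous_at /wgt patchE mem_set//.
apply: cvg_trans; apply: near_eq_cvg.
near=> x; rewrite patchE mem_set//.
by near: x; exact: near_in_itvoo.
Unshelve. all: by end_near. Qed.

(** Substituting x = T y turns the integrand into 1, because the weight cancels the Jacobian
    |T'(y)|. *)
Lemma integral_image u v : u \in `]p, q[ -> v \in `]p, q[ -> u <= v ->
  (\int[mu]_(x in T @` `[u, v]) (wgt (binv x))%:E = (v - u)%:E)%E.
Proof.
move=> upq vpq uv.
have sub : `[u, v] `<=` `]p, q[ := segment_sub_piece upq vpq.
have cT : {within `[u, v], continuous T}.
  by apply: continuous_in_subspaceT => x /[!inE] /sub; exact: piece_continuous.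
have Tinj : {in `[u, v] &, injective T}.
  by move=> x y /sub xpq /sub ypq; exact: piece_inj.
have Timg := continuous_inj_image_segment uv cT Tinj.
have cg : {within T @` `[u, v], continuous (wgt \o binv)}.
  apply: continuous_in_subspaceT => _ /[!inE] -[x /sub xpq <-].
  exact: wgt_binv_continuous.

have wT x : x \in `[u, v] -> wgt (binv (T x)) = `|derive1 T x|^-1.
  by move=> /sub xpq; rewrite binvK// /wgt patchE mem_set.
have T'c x : x \in `[u, v] -> {for x, continuous (derive1 T)} by move=> /sub; exact: cT'.
have uuv : u \in `[u, v] by rewrite in_itv/= lexx.
have vuv : v \in `[u, v] by rewrite in_itv/= lexx andbT.
have T'oo : {in `]u, v[, continuous (derive1 T)}.
  by move=> x xuv; apply: T'c; exact: subset_itv_oo_cc.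
(* Both [u] and [v] are interior to the piece, where T and T' are continuous; this gives the
   one-sided limits that the substitution rule asks for. *)
have T'u : cvg (derive1 T x @[x --> u^'+]).
  by apply: cvgP; apply: cvg_at_right_filter; exact: T'c.
have T'v : cvg (derive1 T x @[x --> v^'-]).
  by apply: cvgP; apply: cvg_at_left_filter; exact: T'c.
have TLR : derivable_oo_LRcontinuous T u v.
  split.
  - by move=> x xuv; apply: dT; apply: sub; exact: subset_itv_oo_cc.
  - by apply: cvg_at_right_filter; apply: piece_continuous.
  - by apply: cvg_at_left_filter; apply: piece_continuous.
have int1 : (\int[mu]_(x in `[u, v]) 1%:E = (v - u)%:E)%E.
  rewrite integral_cst// mul1e [LHS]lebesgue_measure_itv/= lte_fin.
  by move: uv; rewrite le_eqVlt => /orP[/eqP->|->//]; rewrite ltxx subrr.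
have dT_in : {in (`]p, q[%classic : set R), forall x : R, derivable T x 1}.
  by move=> x /[!inE]; exact: dT.
have cTpq : {within `]p, q[, continuous T}.
  by apply: continuous_in_subspaceT => x /[!inE]; exact: piece_continuous.
(* A continuous injection of an interval is strictly monotone; the direction fixes the sign of T'
   and hence the absolute value in the weight. *)
have [incT|decT] := itv_continuous_inj_mono cTpq piece_inj.
- have incTuv : {in `[u, v] &, {homo T : x y / x < y}}.
    by move=> x y /sub xpq /sub ypq; exact: incT.
  have Tuv : T u <= T v by move: uv; rewrite le_eqVlt => /orP[/eqP->//|uv']; exact/ltW/incT.
  have TuvE : T @` `[u, v] = `[T u, T v]%classic.
    by rewrite Timg (min_idPl Tuv) (max_idPr Tuv).
  rewrite TuvE in cg *.
  rewrite (@integration_by_substitution_increasing _ T (wgt \o binv))// -int1.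
  apply: eq_integral => x /[!inE] xuv; congr EFin; rewrite mulrfctE /= wT//.
  rewrite ger0_norm ?mulVf//; first exact/T'0/sub.
  exact: (incr_derive1_ge0_itv dT_in incT (sub _ xuv)).
- have decTuv : {in `[u, v] &, {homo T : x y /~ x < y}}.
    by move=> x y /sub xpq /sub ypq; exact: decT.
  have Tuv : T v <= T u by move: uv; rewrite le_eqVlt => /orP[/eqP->//|uv']; exact/ltW/decT.
  have TuvE : T @` `[u, v] = `[T v, T u]%classic.
    by rewrite Timg (min_idPr Tuv) (max_idPl Tuv).
  rewrite TuvE in cg *.
  rewrite (@integration_by_substitution_decreasing _ T (wgt \o binv))// -int1.
  apply: eq_integral => x /[!inE] xuv; congr EFin; rewrite mulrfctE /= wT//.
  rewrite ler0_norm ?fctE ?mulVf ?oppr_eq0//; first exact/T'0/sub.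
  exact: (decr_derive1_le0_itv dT_in decT (sub _ xuv)).
Qed.

(** The image under [binv] of the measure with density [wgt \o binv]. Once it is known to be a
    measure, uniqueness and continuity from below identify it with Lebesgue measure on the piece. *)
Let mass (E : set (measurableTypeR R)) : \bar R :=
  (\int[mu]_(x in binv @^-1` E) (wgt (binv x))%:E)%E.

Let mass0 : mass set0 = 0%E.
Proof. by rewrite /mass preimage_set0 integral_set0. Qed.

Let mass_ge0 E : (0 <= mass E)%E.
Proof. by apply: integral_ge0 => x _; rewrite lee_fin wgt_ge0. Qed.

Lemma measurable_wgt_binv : measurable_fun setT (fun x => (wgt (binv x))%:E).
Proof.
by apply/measurable_EFinP; apply: measurableT_comp measurable_binv; exact: measurable_wgt.
Qed.

Lemma measurable_binv_preimage (E : set R) : measurable E -> measurable (binv @^-1` E).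
Proof. by move=> mE; rewrite -[_ @^-1` _]setTI; exact: measurable_binv. Qed.

Let mass_sigma : semi_sigma_additive mass.
Proof.
move=> F mF tF mUF; rewrite /mass preimage_bigcup.
apply: (@semi_sigma_additive_nng_induced _ _ _ mu _ measurable_wgt_binv _
  (fun i => binv @^-1` F i)).
- by move=> x; rewrite lee_fin wgt_ge0.
- by move=> i; exact: measurable_binv_preimage (mF i).
- apply/trivIsetP => i j _ _ ij; move/trivIsetP : tF => /(_ i j I I ij) Fij.
  by rewrite -preimage_setI Fij preimage_set0.
- by apply: bigcup_measurable => i _; exact: measurable_binv_preimage (mF i).
Qed.

HB.instance Definition _ := isMeasure.Build _ _ _ mass mass0 mass_ge0 mass_sigma.

Let mass_cc u v : u \in `]p, q[ -> v \in `]p, q[ -> u <= v ->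
  mass `[u, v]%classic = (v - u)%:E.
Proof.
move=> upq vpq uv.
by rewrite /mass binv_preimage ?integral_image//; exact: segment_sub_piece.
Qed.

(** The point [u] has mass zero by [mass_cc]. Half-open intervals arise when a ray cuts a
    segment. *)
Let mass_oc u v : u \in `]p, q[ -> v \in `]p, q[ -> u <= v ->
  mass `]u, v]%classic = (v - u)%:E.
Proof.
move=> upq vpq uv; rewrite -(mass_cc upq vpq uv).
transitivity (mass `[u, u] + mass `]u, v])%E; first by rewrite mass_cc// subrr add0e.
rewrite [in RHS](@itv_bndbnd_setU _ _ _ (BRight u)) ?bnd_simp//.
symmetry; apply: measureU => //=.
by apply/seteqP; split=> // x /=; rewrite !in_itv/= => -[/andP[_ xu] /andP[]]; rewrite ltNge xu.
Qed.

(** Both measures, restricted to the segment, are finite and agree on rays: a ray from [x] misses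
    the segment, contains it up to its right end, or cuts it at [x]. *)
Let mass_segment u v E : u \in `]p, q[ -> v \in `]p, q[ -> u <= v ->
  measurable E -> mass (E `&` `[u, v]) = mu (E `&` `[u, v]).
Proof.
move=> upq vpq uv mE.
pose m1 := mrestr mu (measurable_itv `[u, v]).
pose m2 := mrestr mass (measurable_itv `[u, v]).
symmetry; have := @eq_measure_rays R m1 m2; apply => // [|x].
  by rewrite /m1/= /mrestr setTI [ltLHS]lebesgue_measure_itv/=; case: ifP; rewrite ?ltry.
rewrite /m1 /m2/= /mrestr.
have [vx|xv] := ltP v x.
  rewrite (_ : _ `&` _ = set0) ?measure0//; apply/seteqP; split=> // y /=.
  by rewrite !in_itv/= andbT => -[xy /andP[_ yv]]; move: (lt_trans vx xy); rewrite ltNge yv.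
have [xu|ux] := ltP x u.
  rewrite (_ : _ `&` _ = `[u, v]%classic).
    rewrite mass_cc// [LHS]lebesgue_measure_itv/= lte_fin.
    by move: uv; rewrite le_eqVlt => /orP[/eqP->|->//]; rewrite ltxx subrr.
  apply/seteqP; split=> y /=; rewrite !in_itv/= ?andbT; first by case.
  by move=> /andP[uy yv]; rewrite uy yv (lt_le_trans xu).
have xpq : x \in `]p, q[ by apply: (segment_sub_piece upq vpq); rewrite /= in_itv/= ux.
rewrite (_ : _ `&` _ = `]x, v]%classic).
  rewrite mass_oc// [LHS]lebesgue_measure_itv/= lte_fin.
  by move: xv; rewrite le_eqVlt => /orP[/eqP->|->//]; rewrite ltxx subrr.
apply/seteqP; split=> y /=; rewrite !in_itv/= ?andbT.
  by move=> [-> /andP[]].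
by move=> /andP[xy ->]; rewrite xy (le_trans ux)// ltW.
Qed.

Lemma integral_binv_preimage E : measurable E ->
  (\int[mu]_(x in binv @^-1` E) (wgt (binv x))%:E = mu (E `&` `]p, q[))%E.
Proof.
move=> mE; rewrite -/(mass E).
(* Off the piece the weight vanishes, so only the part of [E] in the piece counts. *)
have -> : mass E = mass (E `&` `]p, q[).
  rewrite /mass !(integral_mkcond (_ @^-1` _)); apply: eq_integral => x _.
  rewrite !patchE; have [xE|xE] := boolP (x \in _ @^-1` E); last first.
    by rewrite ifF//; apply/negbTE; apply: contraNN xE; rewrite !inE => -[].
  case: ifPn => // xEpq; congr EFin; rewrite /wgt patchE ifF//.
  by apply/negbTE; apply: contraNN xEpq; rewrite !inE => xpq; split => //; move: xE; rewrite inE.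
(* Nothing is known of T at [p] and [q], so the open piece is exhausted by segments
   [[p + e n, q - e n]]; the first one is the midpoint, so none is empty. *)
pose e n : R := (q - p) / 2 / n.+1%:R.
pose F n := E `&` `[p + e n, q - e n]%classic.
have e0 n : 0 < e n by rewrite !divr_gt0// subr_gt0.
have e2 n : e n <= (q - p) / 2.
  by rewrite ler_piMr ?divr_ge0 ?subr_ge0 ?(ltW pq)// invf_le1// ler1n.
have mF n : measurable (F n) by apply: measurableI => //; exact: measurable_itv.
have mEpq : measurable (E `&` `]p, q[) by apply: measurableI => //; exact: measurable_itv.
have UF : \bigcup_n F n = E `&` `]p, q[.
  rewrite /F -setI_bigcupr; congr (_ `&` _); apply/seteqP; split=> x /=.
    move=> [n _]/=; rewrite !in_itv/= => /andP[]; have := e0 n; lra.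
  rewrite in_itv/= => /andP[px xq].
  (* The distance from [x] to the nearer end; [x] is in the segment as soon as [e n <= m]. *)
  pose m := Num.min (x - p) (q - x).
  have m0 : 0 < m by rewrite lt_min !subr_gt0 px.
  exists (Num.bound ((q - p) / 2 / m)) => //=.
  set n := Num.bound _.
  have enm : e n <= m.
    rewrite /e ler_pdivrMr// [leRHS]mulrC -ler_pdivrMr//.
    have : (q - p) / 2 / m < n%:R by rewrite archi_boundP// !divr_ge0 ?ltW// subr_gt0.
    by move=> /ltW/le_trans; apply; rewrite ler_nat.
  have mx : m <= x - p by rewrite ge_min lexx.
  have mq : m <= q - x by rewrite ge_min lexx orbT.
  by rewrite in_itv/=; apply/andP; split; lra.
have ndF : {homo F : n m / (n <= m)%N >-> (n <= m)%O}.
  move=> n m nm; apply/subsetPset => x [Ex]; rewrite /= in_itv/= => /andP[nx xn].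
  have emn : e m <= e n.
    by rewrite ler_pM2l ?divr_gt0 ?subr_gt0// lef_pV2 ?posrE// ler_nat.
  by split => //=; rewrite in_itv/=; apply/andP; split; lra.
have mUF : measurable (\bigcup_n F n) by rewrite UF.
have c1 := @nondecreasing_cvg_mu _ _ _ mass F mF mUF ndF.
have c2 := @nondecreasing_cvg_mu _ _ _ mu F mF mUF ndF.
rewrite -UF.
have eqF : mass \o F = mu \o F.
  apply/funext => n /=; apply: mass_segment => //.
  - by rewrite in_itv/=; have := e0 n; have := e2 n; move: pq => *; apply/andP; split; lra.
  - by rewrite in_itv/=; have := e0 n; have := e2 n; move: pq => *; apply/andP; split; lra.
  - by have := e2 n; lra.
rewrite eqF in c1.
exact: (cvg_unique _ c1 c2).
Qed.
End piece.

(** * Consequences of preserving the uniform law *)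

(** Measurability is asked of the part in [[0, 1]] only, so that the lemma covers preimages under T,
    which is known to be measurable only there. *)
Lemma unif01E (R : realType) (B : set R) : measurable (B `&` `[0, 1]) ->
  unif01 R B = lebesgue_measure (B `&` `[0, 1]).
Proof.
move=> mB; rewrite /unif01 /uniform_prob integral_uniform_pdf.
rewrite (eq_integral (fun=> 1%:E)); last first.
  by move=> x /[!inE] -[_]; rewrite /= in_itv/= /uniform_pdf => ->; rewrite subr0 invr1.
by rewrite integral_cst// mul1e.
Qed.

Section udp.
Context {R : realType} (T : R -> R).
Local Notation mu := (@lebesgue_measure R).
Hypothesis udpT : udp T.

Lemma measurable_udp_preimage (B : set R) : measurable B ->
  measurable (T @^-1` B `&` `[0, 1]).
Proof.
by move=> mB; rewrite setIC; case: udpT => _ [mT _]; apply: mT => //; exact: measurable_itv.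
Qed.

Lemma udp_preimage (B : set R) : measurable B ->
  mu (T @^-1` B `&` `[0, 1]) = mu (B `&` `[0, 1]).
Proof.
move=> mB; have [_ [_ /(_ _ mB)]] := udpT.
rewrite !unif01E//; last exact: measurable_udp_preimage.
by apply: measurableI => //; exact: measurable_itv.
Qed.

(* A critical point would have a neighbourhood whose image is shorter than itself. *)
Lemma udp_derive1_neq0 (p q u : R) : `]p, q[ `<=` `[0, 1] ->
  (forall x, x \in `]p, q[ -> derivable T x 1) ->
  {in `]p, q[, continuous (derive1 T)} ->
  u \in `]p, q[ -> derive1 T u != 0.
Proof.
move=> pq01 dT cT' upq; apply/negP => /eqP T'u0.
(* By the mean value theorem, slope at most 1/4 sends [[u - d, u + d]], of length 2d, into an
   interval of length d/2. *)
have : \forall x \near u, (x \in `]p, q[) /\ `|derive1 T x| <= 4^-1.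
  near=> x; split; first by near: x; exact: near_in_itvoo.
  near: x; apply: cvgr0_norm_le; last by rewrite invr_gt0.
  by rewrite -T'u0; exact: cT'.
move=> [e /= e0 He].
(* Halving the radius puts the closed segment inside the open ball. *)
pose d := e / 2.
have d0 : 0 < d by rewrite divr_gt0.
have Hd x : x \in `[u - d, u + d] -> (x \in `]p, q[) /\ `|derive1 T x| <= 4^-1.
  rewrite in_itv/= => xd; apply: He; rewrite /ball_/= ltr_norml; rewrite /d in xd d0; lra.
have Td x : x \in `[u - d, u + d] -> `|T x - T u| <= d / 4.
  have MV y z : u - d <= y -> y <= z -> z <= u + d -> z - y <= d -> `|T z - T y| <= d / 4.
    move=> uy yz zu zyd.
    have sub c : c \in `[y, z] -> c \in `[u - d, u + d].
      by rewrite !in_itv/= => /andP[yc cz]; rewrite (le_trans uy)// (le_trans cz).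
    have [||c cyz ->] := @MVT_segment _ T (derive1 T) y z yz.
    - move=> c cyz; rewrite derive1E; apply: DeriveDef => //.
      by apply: dT; have [] := Hd _ (sub _ (subset_itv_oo_cc cyz)).
    - apply: continuous_in_subspaceT => c /[!inE] /sub /Hd[cpq _].
      by apply/differentiable_continuous/derivable1_diffP/dT.
    rewrite normrM mulrC ler_pM//; last by have [] := Hd _ (sub _ cyz).
    by rewrite ger0_norm// subr_ge0.
  rewrite in_itv/= => /andP[ux xu].
  have [xlu|ulx] := leP x u.
    by rewrite distrC; apply: MV => //; lra.
  by apply: MV => //; lra.
pose B := `[T u - d / 4, T u + d / 4]%classic.
have mB : measurable B by exact: measurable_itv.
(* Invariance fails for [B]: its part in [[0, 1]] has length at most d/2, while its preimage
   contains a segment of length 2d. *)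
have := udp_preimage mB; apply/eqP; rewrite gt_eqF//.
apply: (@le_lt_trans _ _ (d / 2)%:E).
  apply: (@le_trans _ _ (mu B)).
    by apply: le_measure; rewrite ?inE//; apply: measurableI => //; exact: measurable_itv.
  rewrite [leLHS]lebesgue_measure_itv/=; case: ifP => _; last by rewrite lee_fin; lra.
  by rewrite -EFinD lee_fin; lra.
apply: (@lt_le_trans _ _ (mu `[u - d, u + d]%classic)).
  rewrite [ltRHS]lebesgue_measure_itv/= lte_fin ifT; last lra.
  by rewrite -EFinD lte_fin; lra.
apply: le_measure; rewrite ?inE//; first exact: measurable_udp_preimage.
move=> x xd; split; last by apply: pq01; have [] := Hd _ xd.
by rewrite /B /= in_itv/= -ler_distl; exact: Td.
Unshelve. all: by end_near. Qed.

End udp.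

(** * Total weight of the roots over all pieces *)

Section weights.
Context {R : realType} (T : R -> R) (L : nat) (a : nat -> R).
Local Notation mu := (@lebesgue_measure R).
Hypothesis udpT : udp T.
Hypothesis regT : regular_wrt T L a.

Local Notation branch l := (binv T (a l) (a l.+1)).
Local Notation weight l := (wgt T (a l) (a l.+1)).

Lemma partition_lt l : (l < L)%N -> a l < a l.+1.
Proof. by have [[_ [_ [_ +]]] _] := regT; exact. Qed.

Lemma partition_le i j : (i <= j <= L)%N -> a i <= a j.
Proof.
elim: j => [|j IH]; first by rewrite leqn0 => /andP[/eqP->].
rewrite leq_eqVlt => /andP[/predU1P[->//|ij] jL].
by rewrite (le_trans (IH _) (ltW (partition_lt jL)))// -ltnS ij ltnW.
Qed.

Lemma piece_sub01 l : (l < L)%N -> `]a l, a l.+1[ `<=` `[0, 1].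
Proof.
move=> lL x; rewrite /= !in_itv/= => /andP[/ltW lx /ltW xl].
have [[_ [a0 [aL _]]] _] := regT.
have := @partition_le 0 l; rewrite a0 => /(_ (ltnW lL)) => H1.
have := @partition_le l.+1 L; rewrite aL => /(_ _)/(le_trans xl) -> //; last by rewrite lL leqnn.
by rewrite (le_trans _ lx).
Qed.

Lemma piece_derivable l : (l < L)%N ->
  forall x, x \in `]a l, a l.+1[ -> derivable T x 1.
Proof.
by move=> lL x xl; have [_ /(_ l.+1 lL)[+ _]] := regT; apply.
Qed.

Lemma piece_continuous_derive1 l : (l < L)%N ->
  {in `]a l, a l.+1[, continuous (derive1 T)}.
Proof.
by move=> lL x xl; have [_ /(_ l.+1 lL)[_]] := regT; apply; rewrite inE.
Qed.

Lemma piece_derive1_neq0 l : (l < L)%N ->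
  forall x, x \in `]a l, a l.+1[ -> derive1 T x != 0.
Proof.
move=> lL x; apply: (udp_derive1_neq0 udpT).
- exact: piece_sub01.
- exact: piece_derivable.
- exact: piece_continuous_derive1.
Qed.

(** Partition points are null. The induction uses []0, a n]], so that each step adds one open piece
    and its right end. *)
Lemma measure_pieces (E : set R) : measurable E ->
  (\sum_(l < L) mu (E `&` `]a l, a l.+1[) = mu (E `&` `[0%R, 1%R]))%E.
Proof.
move=> mE; have [[_ [a0 [aL _]]] _] := regT.
have mEi (i : interval R) : measurable (E `&` [set` i] : set (measurableTypeR R)).
  by apply: measurableI => //; exact: measurable_itv.
have mE1 x : measurable (E `&` [set x] : set (measurableTypeR R)) by apply: measurableI.
have null x : mu (E `&` [set x]) = 0%E.
  apply/eqP; rewrite -measure_le0 -(lebesgue_measure_set1 x).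
  by apply: le_measure; rewrite ?inE.
have IH n : (n <= L)%N ->
    (\sum_(l < n) mu (E `&` `]a l, a l.+1[) = mu (E `&` `]0%R, a n]))%E.
  elim: n => [_|n IH nL].
    by rewrite big_ord0 a0 set_itvoc0 setI0 measure0.
  rewrite big_ord_recr/= IH; last exact: ltnW.
  have an := partition_lt nL.
  have a0n : 0 <= a n by rewrite -a0 partition_le//= ltnW.
  rewrite (_ : E `&` `]0, a n.+1] =
      (E `&` `]0, a n]) `|` (E `&` `]a n, a n.+1[) `|` (E `&` [set a n.+1])); last first.
    rewrite -!setIUr; congr (_ `&` _).
    apply/seteqP; split=> x /=; rewrite !in_itv/=; lra.
  rewrite [RHS]measureU//.
  - rewrite [X in _ = (_ + X)%E]null adde0 [RHS]measureU//.
    by apply/seteqP; split=> // x /= []; rewrite !in_itv/= => -[_ ?] [_ ?]; lra.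
  - exact: measurableU.
  - by apply/seteqP; split=> // x /= []; rewrite !in_itv/= => -[[_ ?]|[_ ?]] [_ ?]; lra.
rewrite IH// aL (_ : E `&` `[0, 1] = (E `&` [set 0]) `|` (E `&` `]0, 1])); last first.
  rewrite -!setIUr; congr (_ `&` _).
    apply/seteqP; split=> x /=; rewrite !in_itv/=; lra.
rewrite [RHS]measureU//; first by rewrite [X in _ = (X + _)%E]null add0e.
by apply/seteqP; split=> // x /= []; rewrite !in_itv/= => -[_ ?] [_ ?]; lra.
Qed.

(** The function g_E, written as a sum over branches instead of roots, so that measurability and
    integration go term by term. *)
Definition Gsum (E : set R) (x : R) : R := \sum_(l < L) (weight l \_ E) (branch l x).

Lemma Gsum_ge0 E x : 0 <= Gsum E x.
Proof.
by apply: sumr_ge0 => l _; rewrite patchE; case: ifP => // _; exact: wgt_ge0.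
Qed.

Lemma le_Gsum E F x : E `<=` F -> Gsum E x <= Gsum F x.
Proof.
move=> EF; apply: ler_sum => l _; rewrite !patchE.
have [/set_mem/EF xF|_] := boolP (_ \in E); first by rewrite mem_set.
by case: ifP => // _; exact: wgt_ge0.
Qed.

Let mbranch l : (l < L)%N -> measurable_fun setT (branch l).
Proof.
by move=> lL; apply: measurable_binv; 
  [exact: partition_lt|exact: piece_derivable|exact: piece_derive1_neq0].
Qed.

Let mweight l E : (l < L)%N -> measurable E -> measurable_fun setT (weight l \_ E).
Proof.
move=> lL mE; apply/measurable_restrict => //; rewrite setTI.
apply: measurable_funTS; apply: measurable_wgt.
- exact: piece_continuous_derive1.
- exact: piece_derive1_neq0.
Qed.

Lemma measurable_Gsum E : measurable E -> measurable_fun setT (Gsum E).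
Proof.
move=> mE; apply: measurable_sum => l.
by apply: measurableT_comp; [exact: mweight|exact: mbranch].
Qed.

Lemma integral_Gsum E : measurable E ->
  (\int[mu]_x (Gsum E x)%:E = mu (E `&` `[0%R, 1%R]))%E.
Proof.
move=> mE; under eq_integral do rewrite /Gsum -sumEFin.
rewrite ge0_integral_sum//.
- rewrite -measure_pieces//; apply: eq_bigr => l _.
  rewrite -(@integral_binv_preimage _ T)//.
  + rewrite [RHS]integral_mkcond; apply: eq_integral => x _.
    rewrite !patchE (_ : (x \in _ @^-1` E) = (branch l x \in E)); first by case: ifP.
    by apply/idP/idP; rewrite !inE.
  + exact: partition_lt.
  + exact: piece_derivable.
  + exact: piece_continuous_derive1.
  + exact: piece_derive1_neq0.
- move=> l; apply/measurable_EFinP.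
  by apply: measurableT_comp; [exact: mweight|exact: mbranch].
- by move=> l x _; rewrite lee_fin patchE; case: ifP => // _; exact: wgt_ge0.
Qed.

(* [Gsum setT] is a density of the law of [T U], which is uniform. *)
Lemma Gsum_setT_ae :
  ae_eq mu setT (fun x => (\1_(`[0, 1]%classic) x)%:E) (fun x => (Gsum setT x)%:E).
Proof.
apply: integral_ae_eq => //.
- exact: integrable_indic_itv.
- by apply/measurable_EFinP; exact: measurable_Gsum.
move=> B _ mB; rewrite integral_indic// [in LHS]setIC.
rewrite -[LHS](udp_preimage udpT)//.
have mTB := measurable_udp_preimage udpT mB.
(* The preimage of [B] is measurable only within [[0, 1]], so one copy of [[0, 1]] goes into the set
   fed to [integral_Gsum]. *)
rewrite -[in LHS](setIid `[0, 1]%classic) setIA -integral_Gsum//.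
rewrite [RHS]integral_mkcond; apply: eq_integral => x _.
(* If [x] is in [B], every root of T r = x lies in the preimage of [B]; otherwise none does. *)
rewrite patchE; have [xB|xB] := boolP (x \in B).
  congr EFin; apply: eq_bigr => l _; rewrite !patchE in_setT /wgt patchE.
  have [xl|_] := boolP (_ \in `]a l, a l.+1[%classic); last by case: ifP.
  rewrite mem_set//; split; last by apply: (piece_sub01 (ltn_ord l)); move: xl; rewrite inE.
  by move: xl; rewrite inE => /= /binvE; rewrite /preimage/= => ->; exact: set_mem.
congr EFin; apply: big1 => l _; rewrite patchE /wgt patchE; case: ifPn => // /set_mem[/=].
case: ifPn => // xl; rewrite binvE; last by move: xl; rewrite inE.
by move=> /mem_set; rewrite (negbTE xB).
Qed.

(** Each piece holds at most one root, the value of its branch, and the pieces are disjoint. [A n]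
    collects the roots up to [t] in the first [n] pieces. *)
Lemma Gx_Gsum x t : Gx T L a x t = Gsum `]-oo, t] x.
Proof.
pose A n := [set r | exists2 l, (l < n)%N & [/\ r \in `]a l, a l.+1[, T r = x & r <= t]].
have AE : [set r | Aset L a r /\ T r = x /\ r <= t] = A L.
  apply/seteqP; split=> r /=.
    by move=> [[[|l]//= lL rl] [Trx rt]]; exists l.
  by move=> [l lL [rl Trx rt]]; split => //; exists l.+1.
rewrite /Gx AE /Gsum.
have A1 l : (l < L)%N ->
    [set r | [/\ r \in `]a l, a l.+1[, T r = x & r <= t]] =
    if (branch l x \in `]a l, a l.+1[) && (branch l x <= t) then [set branch l x] else set0.
  move=> lL.
  have K := binvK (piece_derivable lL) (piece_derive1_neq0 lL).
  apply/seteqP; split=> r /=.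
    by move=> [rl <- rt]; rewrite K// rl rt.
  by case: ifP => // /andP[xl xt] ->; split => //; rewrite binvE.
(* Finiteness is carried along because splitting the sum over a union requires it. *)
suff H n : (n <= L)%N -> finite_set (A n) /\
    \sum_(r \in A n) `|derive1 T r|^-1 = \sum_(l < n) (weight l \_ `]-oo, t]) (branch l x).
  by have [] := H _ (leqnn L).
elim: n => [_|n IH nL].
  have -> : A 0%N = set0 by apply/seteqP; split=> // r [].
  by rewrite fsbig_set0 big_ord0.
have [fA IHA] := IH (ltnW nL).
have -> : A n.+1 = A n `|` [set r | [/\ r \in `]a n, a n.+1[, T r = x & r <= t]].
  apply/seteqP; split=> r /=.
    by move=> [l]; rewrite ltnS leq_eqVlt => /predU1P[->|ln] Hr; [right|left; exists l].
  move=> [[l ln Hr]|Hr]; [exists l => //; exact: ltnW|by exists n].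
have fA1 : finite_set [set r | [/\ r \in `]a n, a n.+1[, T r = x & r <= t]].
  by rewrite A1//; case: ifP.
split; first by rewrite finite_setU.
rewrite fsbigU0//; last first.
  move=> r [[l ln [+ _ _]] [+ _ _]]; rewrite !in_itv/= => /andP[_ rl] /andP[nr _].
  have := @partition_le l.+1 n; rewrite ln => /(_ (ltnW nL)) h.
  by move: (lt_le_trans rl h) => /(lt_trans nr); rewrite ltxx.
rewrite IHA big_ord_recr/=; congr (_ + _); rewrite A1// /wgt !patchE.
rewrite (_ : (_ \in `]-oo, t]%classic) = (branch n x <= t)); last first.
  by apply/idP/idP; rewrite !inE/= in_itv.
rewrite (_ : (_ \in `]a n, a n.+1[%classic) = (branch n x \in `]a n, a n.+1[)); last first.
  by apply/idP/idP; rewrite !inE.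
by case: (branch n x <= t); case: (branch n x \in _); rewrite ?fsbig_set1 ?fsbig_set0.
Qed.

End weights.

(** * Stochastic inverse: level sets, measurability, sections *)

Section stoch_inv.
Context {R : realType} (T : R -> R) (L : nat) (a : nat -> R).
Local Notation mu := (@lebesgue_measure R).
Hypothesis udpT : udp T.
Hypothesis regT : regular_wrt T L a.
Local Notation Gsum := (Gsum T L a).

Lemma Gsum_setI01 E x : Gsum (E `&` `[0, 1]) x = Gsum E x.
Proof.
apply: eq_bigr => l _; rewrite !patchE /wgt !patchE.
have [xl|_] := boolP (_ \in `]a l, a l.+1[%classic); last by case: ifP; case: ifP.
rewrite (_ : (_ \in E `&` _) = (binv T (a l) (a l.+1) x \in E))//.
apply/idP/idP; rewrite !inE; first by case.
by split => //; apply: (piece_sub01 regT (ltn_ord l)); move: xl; rewrite inE.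
Qed.

Lemma Gsum_setT_split t x : Gsum setT x = Gsum `]-oo, t] x + Gsum `]t, +oo[ x.
Proof.
rewrite -big_split/=; apply: eq_bigr => l _; rewrite !patchE in_setT.
set r := binv _ _ _ _; have [rt|tr] := leP r t.
  by rewrite mem_set/= ?in_itv//= memNset/= ?addr0// in_itv/= andbT =>
    /(le_lt_trans rt); rewrite ltxx.
rewrite memNset/= ?in_itv/= ?add0r; last by apply/negP; rewrite -ltNge.
by rewrite mem_set//= in_itv/= tr.
Qed.

Lemma Gsum_setT_eq0 x : ~ (T @` Aset L a) x -> Gsum setT x = 0.
Proof.
move=> xT; apply: big1 => l _; rewrite patchE in_setT /wgt patchE.
case: ifPn => // /set_mem xl; exfalso; apply: xT.
by exists (binv T (a l) (a l.+1) x); [exists l.+1 => //=; exact: ltn_ord|exact: binvE].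
Qed.

Lemma Gsum_lt0 t x : t < 0 -> Gsum `]-oo, t] x = 0.
Proof.
move=> t0; rewrite -Gsum_setI01 (_ : _ `&` _ = set0).
  by apply: big1 => l _; rewrite patchE in_set0.
by apply/seteqP; split=> // r /=; rewrite !in_itv/= => -[? /andP[? ?]]; lra.
Qed.

(** The Galois property of the generalised inverse, which rests on right-continuity of G_x. The
    bound on [z] is the total weight, as this equals one only for almost every [x] in [[0, 1]]. *)
Lemma stoch_inv_le x z t : 0 < z <= Gsum setT x ->
  (stoch_inv T L a x z <= t) = (z <= Gsum `]-oo, t] x).
Proof.
move=> /andP[z0 zW]; rewrite /stoch_inv ifT; last first.
  by apply/asboolP; apply: contrapT => /Gsum_setT_eq0 W0; move: z0; rewrite ltNge -W0 zW.
set S := [set _ | _].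
have SE y : S y = (z <= Gsum `]-oo, y] x) by rewrite /S /= (Gx_Gsum udpT regT).
have S0 : S !=set0.
  (* All roots lie in [[0, 1]], so G_x has reached the total weight at 1. *)
  exists 1; rewrite SE (le_trans zW)// -Gsum_setI01 setTI.
  by apply: le_Gsum => r; rewrite /= !in_itv/= => /andP[].
have lS : lbound S 0.
  move=> y; rewrite SE => zy; rewrite leNgt; apply/negP => y0.
  by move: zy; rewrite Gsum_lt0// leNgt z0.
apply/idP/idP => [|zt]; last by apply: ge_inf; [exists 0|rewrite SE].
apply: contraTT; rewrite -!ltNge => tz.
(* Right-continuity: no branch value lies in []t, m[], so G_x is constant on [[t, m[]. *)
have [m tm Hm] : exists2 m, t < m & forall l, (l < L)%N ->
    t < binv T (a l) (a l.+1) x -> m <= binv T (a l) (a l.+1) x.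
  elim: L => [|n [m tm Hm]]; first by exists (t + 1) => //; rewrite ltrDl.
  have [tn|nt] := ltP t (binv T (a n) (a n.+1) x).
    exists (Num.min m (binv T (a n) (a n.+1) x)); first by rewrite lt_min tm.
    move=> l; rewrite ltnS leq_eqVlt => /predU1P[->|ln] tl; rewrite ge_min ?lexx ?orbT//.
    by rewrite Hm.
  exists m => // l; rewrite ltnS leq_eqVlt => /predU1P[->|ln]; last exact: Hm.
  by rewrite ltNge nt.
apply: (lt_le_trans tm); apply: lb_le_inf => // y; rewrite SE => zy.
rewrite leNgt; apply/negP => ym; move: tz; apply/negP; rewrite -leNgt (le_trans zy)//.
apply: ler_sum => l _; rewrite !patchE.
case: ifPn => [/set_mem|_]; last by case: ifP => // _; exact: wgt_ge0.
rewrite /= in_itv/= => ly; rewrite mem_set//= in_itv/= leNgt; apply/negP => /(Hm _ (ltn_ord l)).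
by rewrite leNgt (le_lt_trans ly ym).
Qed.

(** For [z <= 0] the level set is the whole line, for [z] above the total weight it is empty; [inf]
    is 0 by convention in both cases. *)
Lemma stoch_inv_eq0 x z : ~~ (0 < z <= Gsum setT x) -> stoch_inv T L a x z = 0.
Proof.
rewrite negb_and -leNgt -ltNge /stoch_inv => /orP zx; case: asboolP => // _.
case: zx => [z0|Wz].
  apply: inf_out => -[_ [m mS]]; have : m <= m - 1.
    by apply: mS; rewrite /= (Gx_Gsum udpT regT) (le_trans z0)// Gsum_ge0.
  by lra.
rewrite (_ : [set _ | _] = set0) ?inf0//; apply/seteqP; split=> // y /=.
by rewrite (Gx_Gsum udpT regT) leNgt (le_lt_trans _ Wz)// le_Gsum.
Qed.

(** The two preceding lemmas describe the set where the inverse is at most [t], for all pairs, by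
    inequalities between [z] and measurable functions of [x]. *)
Lemma measurable_stoch_inv :
  measurable_fun setT (fun xz : R * R => stoch_inv T L a xz.1 xz.2).
Proof.
have msub E : measurable E -> measurable [set xz : R * R | 0 < xz.2 <= Gsum E xz.1].
  move=> mE.
  have -> : [set xz : R * R | 0 < xz.2 <= Gsum E xz.1] =
     (snd @^-1` `]0, +oo[) `&` ((fun xz : R * R => Gsum E xz.1 - xz.2) @^-1` `[0, +oo[).
    by apply/seteqP; split=> xz /=; rewrite !in_itv/= !andbT subr_ge0 => /andP.
  apply: measurableI; rewrite -[X in measurable X]setTI.
    by apply: measurable_snd => //; exact: measurable_itv.
  suff : measurable_fun setT (fun xz : R * R => Gsum E xz.1 - xz.2).
    by apply => //; exact: measurable_itv.
  apply: measurable_funB; last exact: measurable_snd.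
  by apply: measurableT_comp measurable_fst; exact: measurable_Gsum.
apply: (measurability (@RGenOInfty.G R)); first exact: RGenOInfty.measurableE.
move=> _ [_ [t ->] <-]; rewrite setTI.
rewrite (_ : _ @^-1` _ = ~` ([set xz : R * R | 0 < xz.2 <= Gsum `]-oo, t] xz.1] `|`
   ([set xz | 0 <= t] `&` ~` [set xz : R * R | 0 < xz.2 <= Gsum setT xz.1]))).
  apply: measurableC; apply: measurableU; first by apply: msub; exact: measurable_itv.
  apply: measurableI; last by apply: measurableC; exact: msub.
  have [t0|t0] := boolP (0 <= t).
    by rewrite (_ : [set _ | _] = setT)//; apply/seteqP; split.
  by rewrite (_ : [set _ | _] = set0)//; apply/seteqP; split.
apply/seteqP; split=> -[x z] /=; rewrite in_itv/= andbT [t < _]ltNge.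
  move=> /negP xz [/andP[z0 zG]|[t0 /negP]]; last first.
    by move=> /stoch_inv_eq0 xz0; apply: xz; rewrite xz0.
  apply: xz; rewrite stoch_inv_le// z0 (le_trans zG)//.
  exact: le_Gsum.
move=> xz; apply/negP => xzt; apply: xz.
have [zW|zW] := boolP (0 < z <= Gsum setT x).
  by left; move: xzt; rewrite stoch_inv_le//; case/andP: zW => ->.
by right; split; [move: xzt; rewrite stoch_inv_eq0|exact/negP].
Qed.

Lemma measurable_stoch_inv_gt (t : R) :
  measurable [set xz : R * R | t < stoch_inv T L a xz.1 xz.2].
Proof.
rewrite (_ : [set _ | _] = setT `&`
    (fun xz : R * R => stoch_inv T L a xz.1 xz.2) @^-1` `]t, +oo[).
  by apply: measurable_stoch_inv => //; exact: measurable_itv.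
by rewrite setTI; apply/seteqP; split=> xz /=; rewrite in_itv/= andbT.
Qed.

Lemma xsection_stoch_inv x t : Gsum setT x = 1 ->
  unif01 R (xsection [set xz : R * R | t < stoch_inv T L a xz.1 xz.2] x) =
  (Gsum `]t, +oo[ x)%:E.
Proof.
move=> W1; set S := [set _ | _].
have mS : measurable S := measurable_stoch_inv_gt t.
have mSx : measurable (xsection S x `&` `[0, 1]).
  by apply: measurableI; [exact: measurable_xsection|exact: measurable_itv].
rewrite unif01E//.
have Wsplit := Gsum_setT_split t x.
pose g := Gsum `]-oo, t] x.
have g0 : 0 <= g := Gsum_ge0 _ _ _ _ _.
have g'0 : 0 <= Gsum `]t, +oo[ x := Gsum_ge0 _ _ _ _ _.
have gW : Gsum `]t, +oo[ x = 1 - g by rewrite /g; lra.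
have g1 : g <= 1 by lra.
have SE z : 0 < z <= 1 -> xsection S x z = (g < z).
  by move=> z01; rewrite /xsection/= !inE /S /= ltNge stoch_inv_le ?W1// -ltNge.
have mu_itv b : mu [set` Interval (BSide b g) (BRight 1)] = (1 - g)%:E.
  rewrite [LHS]lebesgue_measure_itv/= lte_fin; case: ltP => // g1'.
  by congr EFin; lra.
(* The section is squeezed between []g, 1]] and [[g, 1]]. At z = 0 the inverse is 0, so membership
   means t < 0, which forces g = 0. *)
rewrite gW; apply/eqP; rewrite eq_le; apply/andP; split.
  rewrite -(mu_itv true); apply: le_measure; rewrite ?inE//.
  move=> z [Sz]; rewrite /= !in_itv/= => /andP[z0 z1]; rewrite z1 andbT.
  have [z00|z00] := ltP 0 z; first by apply/ltW; rewrite -SE ?z00.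
  have zE : z = 0 by apply/eqP; rewrite eq_le z00.
  move: Sz; rewrite /xsection/= inE /S /= stoch_inv_eq0 ?zE ?ltxx// => t0.
  by rewrite /g Gsum_lt0.
rewrite -(mu_itv false); apply: le_measure; rewrite ?inE//.
move=> z; rewrite /= !in_itv/= => /andP[gz z1].
have z0 : 0 < z := le_lt_trans g0 gz.
by rewrite (ltW z0) z1 SE ?z0.
Qed.

Lemma integral_xsection_stoch_inv (t : R) :
  (\int[unif01 R]_x
     unif01 R (xsection [set xz : R * R | (t < stoch_inv T L a xz.1 xz.2)%R] x) =
   unif01 R `]t, +oo[%classic)%E.
Proof.
set S := [set _ | _].
have mS : measurable S := measurable_stoch_inv_gt t.
have mf : measurable_fun setT (fun x => unif01 R (xsection S x)).
  exact: (measurable_fun_xsection (unif01 R) mS).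
rewrite [LHS]integral_uniform// subr0 invr1 mul1e integral_mkcond.
have m01 : measurable (`]t, +oo[ `&` `[0, 1] : set (measurableTypeR R)).
  by apply: measurableI; exact: measurable_itv.
rewrite [RHS]unif01E// -(integral_Gsum udpT regT)//.
apply: ge0_ae_eq_integral => //.
- by apply/measurable_restrict => //; rewrite setTI; exact: measurable_funTS.
- by apply/measurable_EFinP; exact: measurable_Gsum.
- by move=> x _; rewrite patchE; case: ifP.
- by move=> x _; rewrite lee_fin Gsum_ge0.
(* For almost every [x], the total weight is 1 inside [[0, 1]], where the section formula applies,
   and 0 outside, where both integrands vanish. *)
have := Gsum_setT_ae udpT regT; apply: filterS => x /(_ I) [].
rewrite indicE patchE; case: ifP => x01 /= W _.
  by rewrite xsection_stoch_inv.
congr EFin; apply/eqP; rewrite eq_le Gsum_ge0/= [leRHS]W.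
exact: le_Gsum.
Qed.

End stoch_inv.

(** * Joint law of the independent pair and conclusion *)

(** Independence makes the law of the pair agree with the product measure on rectangles, hence
    everywhere; the product measure integrates sections. *)
Lemma indep2_unif01 (R : realType) (d : measure_display) (O : measurableType d)
    (P : probability O R) (V Z : O -> R) :
  is_unif01 P V -> is_unif01 P Z -> indep2 P V Z ->
  forall S : set (R * R), measurable S ->
  P ((fun w => (V w, Z w)) @^-1` S) = (\int[unif01 R]_x unif01 R (xsection S x))%E.
Proof.
move=> [mV VU] [mZ ZU] VZ S mS.
pose VZf : {mfun O >-> (measurableTypeR R * measurableTypeR R)%type} :=
  mfun_Sub (mem_set
    (@measurable_fun_pair _ _ _ O (measurableTypeR R) (measurableTypeR R) _ _ mV mZ)).
rewrite -/(product_measure1 (unif01 R) (unif01 R) S).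
rewrite (@product_measure_unique _ _ _ _ _ (unif01 R) (unif01 R) (pushforward P VZf))//.
by move=> A B mA mB; apply: (etrans (VZ A B mA mB)); rewrite VU// ZU.
Qed.

Unset Implicit Arguments.

Theorem theorem2 (R : realType) (T : R -> R) (L : nat) (a : nat -> R)
    (d : measure_display) (O : measurableType d) (P : probability O R)
    (V Z : O -> R) :
  udp T -> regular_wrt T L a ->
  is_unif01 P V -> is_unif01 P Z -> indep2 P V Z ->
  is_unif01 P (fun w => stoch_inv T L a (V w) (Z w)).
Proof.
move=> udpT regT UV UZ VZ.
have mX : measurable_fun setT (fun w => stoch_inv T L a (V w) (Z w)).
  have := measurableT_comp (measurable_stoch_inv udpT regT) (measurable_fun_pair UV.1 UZ.1).
  exact.
split=> // B mB.
pose X : {mfun O >-> measurableTypeR R} := 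
  HB.pack (fun w => stoch_inv T L a (V w) (Z w))
    (@isMeasurableFun.Build _ _ O (measurableTypeR R) _ mX).
(* It suffices to compare the law of the inverse with the uniform law on rays, where the section
   integral gives it. *)
have := @eq_measure_rays R (pushforward P X) (unif01 R); apply => // [|t].
  by rewrite /= /pushforward preimage_setT probability_setT ltry.
apply: etrans (integral_xsection_stoch_inv udpT regT t).
rewrite -(indep2_unif01 UV UZ VZ); last exact: measurable_stoch_inv_gt.
by rewrite /= /pushforward; congr (P _); apply/seteqP; split=> w /=; rewrite in_itv/= andbT.
Qed.
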